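(* Let $m\ge 2$ be an integer, and let $A\ge 1$, $B\ge 0$, $C\ge 1$ be integers such that $p(An+B)\equiv 0 \pmod{C}$ for all integers $n\ge 0$. If $B<A$ and $A\mid m$, then for every positive integer $k$ and every integer $n\ge 0$, $$o_{\rho,m}(An+B,k)\equiv 0 \pmod{C}.$$
   Context: $p(n)$ denotes the number of partitions of $n$. Part-frequency matrices: fix an integer modulus $m\ge 2$. Every positive integer $N$ can be written uniquely as $N=jm^k$ with $k\ge 0$ and $m\nmid j$. For a partition $\lambda$, write the number of times the part $N$ occurs in base $m$ as $\sum_{\ell\ge 0} a_{N,\ell}m^\ell$ with digits $a_{N,\ell}\in\{0,\dots,m-1\}$. For each $j\ge 1$ with $m\nmid j$, let $M_j$ be the infinite matrix, with rows and columns indexed from $0$, whose entry in row $k$, column $\ell$ is $a_{jm^k,\ell}$. The partition is recovered from the sequence $(M_j)$; an entry $a$ at position $(k,\ell)$ of $M_j$ contributes $a\cdot j\cdot m^{k+\ell}$ to the weight of the partition. The map $\rho$ (depending on $m$): apply to every matrix $M_j$ the following rotation of each antidiagonal. The entry at position $(k,\ell)$ with $\ell\ge 1$ moves to position $(k+1,\ell-1)$, and the entry at position $(k,0)$ moves to position $(0,k)$. The resulting sequence of matrices defines a new partition of the same integer, so $\rho$ is a permutation of the finite set of partitions of $n$. $o_{\rho,m}(n,k)$ denotes the number of orbits of size $k$ of $\rho$ (with modulus $m$) acting on the set of partitions of $n$. *)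

(* Defs.v *)
From mathcomp Require Import all_boot.
Set Implicit Arguments. Unset Strict Implicit. Unset Printing Implicit Defensive.

(* A partition of n is encoded by its multiplicity function:
   f : {ffun 'I_n -> 'I_n.+1}, where f i is the number of times the part i+1
   occurs; f encodes a partition of n iff \sum_i (i+1) * f i = n. *)
Definition pcode (n : nat) := {ffun 'I_n -> 'I_n.+1}.

Definition partitions (n : nat) : {set pcode n} :=
  [set f : pcode n | \sum_(i < n) i.+1 * f i == n].

Definition npart (n : nat) : nat := #|partitions n|.

Definition mult_of n (f : pcode n) (N : nat) : nat :=
  match N with
  | 0 => 0
  | N'.+1 => match insub N' : option 'I_n with Some i => val (f i) | None => 0 end
  end.

Definition digit (m x l : nat) : nat := (x %/ m ^ l) %% m.

Definition mval (m N : nat) : nat := \max_(k < N.+1 | m ^ k %| N) k.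

Definition pfmat (m : nat) (mu : nat -> nat) (j k l : nat) : nat :=
  digit m (mu (j * m ^ k)) l.

(* the antidiagonal rotation: the entry at (k,l), l>=1, moves to (k+1,l-1);
   the entry at (k,0) moves to (0,k).  So the new entry at (k',l') is
   M(k'-1, l'+1) if k' >= 1, and M(l', 0) if k' = 0. *)
Definition rotmat (M : nat -> nat -> nat -> nat) (j k' l' : nat) : nat :=
  match k' with
  | 0 => M j l' 0
  | k.+1 => M j k l'.+1
  end.

(* recover the multiplicity of part N = j m^k from matrices:
   sum_l M_j(k,l) m^l.  For partitions of n all entries with l > n vanish,
   so the sum is truncated at l <= n. *)
Definition mult_of_mats (m bound : nat) (M : nat -> nat -> nat -> nat) (N : nat) : nat :=
  let k := mval m N in
  let j := N %/ m ^ k in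
  \sum_(l < bound.+1) M j k l * m ^ l.

Definition rho (m n : nat) (f : pcode n) : pcode n :=
  [ffun i : 'I_n =>
     inord (mult_of_mats m n (rotmat (pfmat m (mult_of f))) i.+1)].

Definition o_rho (m n k : nat) : nat :=
  #|[set [set y | fconnect (rho m (n:=n)) x y] | x in partitions n
        & order (rho m (n:=n)) x == k]|.

(* Main.v *)
(* The rotation fixes the top left corners of the matrices M_j, and all other entries contribute
   multiples of m to the weight.  Let a(N) be the number of partitions of N whose
   entries outside the corners vanish, and d(r) the number of partitions of r with zero corners.
   Then p(N) = sum_r a(N - r) d(r), where d(0) = 1 and d is supported on multiples of m, hence of A;
   so C | a(An+B) by induction on n.  The corners do not affect the size of an orbit, so
   o(N,k) = sum_r a(N - r) c_k(r), where c_k(r) counts the orbits of size k with zero corners and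
   weight r, and the congruence for a gives the one for o. *)
Require Import Defs.
From mathcomp Require Import all_boot.
From mathcomp Require Import zify.
Set Implicit Arguments. Unset Strict Implicit. Unset Printing Implicit Defensive.

(** * Base [m] digits and the exponent of [m] in an integer *)

Section Digits.
Variable m : nat.
Hypothesis m_gt1 : 1 < m.

Lemma ltn_digit x l : digit m x l < m.
Proof. by rewrite ltn_mod; lia. Qed.

Lemma digit0n l : digit m 0 l = 0.
Proof. by rewrite /digit div0n mod0n. Qed.

Lemma digitS x l : digit m x l.+1 = digit m (x %/ m) l.
Proof. by rewrite /digit expnS divnMA. Qed.

Lemma sum_digits b x : x < m ^ b -> \sum_(l < b) digit m x l * m ^ l = x.
Proof.
elim: b x => [|b IHb] x; first by rewrite big_ord0 expn0; case: x.
rewrite expnS mulnC => x_lt; rewrite big_ord_recl /= muln1.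
under eq_bigr do rewrite /bump /= add1n digitS expnS mulnCA.
rewrite -big_distrr /= IHb ?ltn_divLR //; last by lia.
by rewrite /digit expn0 divn1 addnC mulnC -divn_eq.
Qed.

Lemma digit_sum b (d : nat -> nat) l : (forall i, d i < m) ->
  digit m (\sum_(i < b) d i * m ^ i) l = if l < b then d l else 0.
Proof.
move=> d_lt; elim: b d d_lt l => [|b IHb] d d_lt l.
  by rewrite big_ord0 digit0n.
rewrite big_ord_recl /= muln1.
under eq_bigr do rewrite /bump /= add1n expnS mulnCA.
rewrite -big_distrr /=; case: l => [|l].
  by rewrite /digit expn0 divn1 addnC mulnC modnMDl modn_small.
rewrite digitS addnC mulnC divnMDl ?divn_small ?addn0 //; last by lia.
exact: (IHb (fun i => d i.+1)).
Qed.

Lemma leq_pexp_mval k N : 0 < N -> m ^ k %| N -> k <= mval m N.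
Proof.
(* The maximum in [mval] ranges over exponents up to [N], and [k < m ^ k <= N]. *)
move=> N_gt0 dvdN; have kN : k < N.+1.
  by have := dvdn_leq N_gt0 dvdN; have := ltn_expl k m_gt1; lia.
exact: (bigmax_sup (Ordinal kN)).
Qed.

Lemma pexp_mval_dvd N : m ^ mval m N %| N.
Proof.
rewrite /mval; elim/big_ind: _ => [|x y|i //]; first by rewrite dvd1n.
by rewrite /maxn; case: ifP.
Qed.

Lemma mvalE j k : ~~ (m %| j) -> mval m (j * m ^ k) = k.
Proof.
move=> ndvd; have j_gt0 : 0 < j by case: j ndvd => //; rewrite dvdn0.
have mk_gt0 : 0 < m ^ k by rewrite expn_gt0; lia.
apply/eqP; rewrite eqn_leq leq_pexp_mval ?muln_gt0 ?j_gt0 ?dvdn_mull // andbT.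
rewrite leqNgt; apply: contra ndvd => lt_k.
have : m ^ k.+1 %| j * m ^ k by apply: dvdn_trans (pexp_mval_dvd _); apply: dvdn_exp2l.
by rewrite expnS dvdn_pmul2r.
Qed.

Lemma mval_core N : 0 < N -> ~~ (m %| N %/ m ^ mval m N).
Proof.
move=> N_gt0; apply/negP => dvd.
have : m ^ (mval m N).+1 %| N.
  by rewrite -{2}(divnK (pexp_mval_dvd N)) expnS dvdn_mul.
by move/(leq_pexp_mval N_gt0); rewrite ltnn.
Qed.

Lemma mval_eq0 N : 0 < N -> (mval m N == 0) = ~~ (m %| N).
Proof.
move=> N_gt0; apply/eqP/idP => [N0|ndvd].
  by have := mval_core N_gt0; rewrite N0 divn1.
by have := mvalE 0 ndvd; rewrite muln1.
Qed.

(** * The rotation as a weight-preserving bijection of positions *)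

(* [src p] is the position from which the rotation fetches its new entry at [p]; the position
   [(N, l)] stands for row [k], column [l] of [M_j], where [N = j * m ^ k]. *)
Definition src (p : nat * nat) : nat * nat :=
  if m %| p.1 then (p.1 %/ m, p.2.+1) else (p.1 * m ^ p.2, 0).

(** An entry in column 0, row [k] of [M_j] goes to row 0, column [k], which is the position [(j, k)]
    of the part [j] itself. *)
Definition dst (p : nat * nat) : nat * nat :=
  if p.2 is l.+1 then (p.1 * m, l) else (p.1 %/ m ^ mval m p.1, mval m p.1).

Definition pweight (p : nat * nat) := p.1 * m ^ p.2.

Lemma srcK p : 0 < p.1 -> dst (src p) = p.
Proof.
case: p => N l /= N_gt0; rewrite /src /=; case: ifP => [/divnK dvd|/negbT ndvd].
  by rewrite /dst /= dvd.
by rewrite /dst /= mvalE // mulnK // expn_gt0; lia.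
Qed.

Lemma dstK p : 0 < p.1 -> src (dst p) = p.
Proof.
case: p => N [|l] /= N_gt0; rewrite /src /dst /=.
  by rewrite (negPf (mval_core N_gt0)) divnK // pexp_mval_dvd.
by rewrite dvdn_mull // mulnK //; lia.
Qed.

Lemma pweight_src p : pweight (src p) = pweight p.
Proof.
case: p => N l; rewrite /src /pweight /=; case: ifP => [/divnK dvd|_] /=.
  by rewrite expnS mulnA dvd.
by rewrite muln1.
Qed.

Lemma src_gt0 p : (0 < (src p).1) = (0 < p.1).
Proof.
have := pweight_src p; rewrite /pweight => /(congr1 (ltn 0)) /=.
by rewrite !muln_gt0 !expn_gt0 (ltnW m_gt1) !andbT.
Qed.

(* The positions at the top left corner of the matrices, which [src] fixes. *)
Definition corner (p : nat * nat) := (p.2 == 0) && ~~ (m %| p.1).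

Lemma src_corner p : corner p -> src p = p.
Proof. by case: p => N l /andP[/eqP /= -> /negPf ndvd]; rewrite /src /= ndvd muln1. Qed.

Lemma corner_src p : corner (src p) = corner p.
Proof.
case: p => N l; rewrite /src /corner /=; case: ifP => ndvd /=.
  by rewrite andbF.
by case: l => [|l] /=; rewrite ?muln1 ?ndvd // expnS mulnCA dvdn_mulr.
Qed.

Lemma dvdn_pweight p : ~~ corner p -> m %| pweight p.
Proof.
case: p => N l; rewrite /corner /pweight negb_and negbK /=.
by case: l => [/= dvd|l _]; [rewrite dvdn_mulr | rewrite expnS mulnCA dvdn_mulr].
Qed.

(** * Finite sums over the positions of bounded weight *)

Definition box n := [seq p <- [seq (N, l) | N <- iota 1 n, l <- iota 0 n.+1] | pweight p <= n].

(** Cutting the columns at [n] loses nothing, because [l < m ^ l <= pweight (N, l)] when [N > 0]. *)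
Lemma mem_box n p : (p \in box n) = (0 < p.1) && (pweight p <= n).
Proof.
rewrite mem_filter andbC; case: p => N l; rewrite /pweight [fst _]/= [snd _]/=.
apply/andP/andP => [[/allpairsPdep[N' [l' [+ _ [-> _]]]] ->]|[N_gt0 le_n]].
  by rewrite mem_iota => /andP[].
split=> //; apply/allpairsPdep; exists N, l; rewrite !mem_iota.
have lt_l := ltn_expl l m_gt1.
by split=> //; nia.
Qed.

Lemma box_uniq n : uniq (box n).
Proof.
apply: filter_uniq; apply: allpairs_uniq; rewrite ?iota_uniq //.
by move=> [? ?] [? ?].
Qed.

Lemma box_src n p : (src p \in box n) = (p \in box n).
Proof. by rewrite !mem_box src_gt0 pweight_src. Qed.

(** Since [src] preserves the weight and the positivity of the part and has inverse [dst], it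
    permutes the box. *)
Lemma sum_box_src n (F : nat * nat -> nat) :
  \sum_(p <- box n) F (src p) = \sum_(p <- box n) F p.
Proof.
rewrite -(big_map src xpredT); apply: perm_big; apply: uniq_perm (box_uniq n) _.
  rewrite map_inj_in_uniq ?box_uniq // => p q.
  rewrite !mem_box => /andP[p0 _] /andP[q0 _] eq_pq.
  by rewrite -(srcK p0) eq_pq srcK.
move=> p; apply/mapP/idP => [[q q_box ->]|p_box]; first by rewrite box_src.
have p0 : 0 < p.1 by move: p_box; rewrite mem_box => /andP[].
by exists (dst p); rewrite ?dstK // -box_src dstK.
Qed.

Lemma sum_box_widen M n (F : nat * nat -> nat) : M <= n ->
  (forall p, p \notin box M -> F p = 0) ->
  \sum_(p <- box n) F p = \sum_(p <- box M) F p.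
Proof.
move=> le_Mn F0; rewrite (bigID (fun p => p \in box M)) /= addnC big1 ?add0n //.
rewrite -big_filter; apply: perm_big; apply: uniq_perm (filter_uniq _ (box_uniq n)) (box_uniq M) _.
move=> p; rewrite mem_filter !mem_box.
by case: (0 < p.1) => //=; apply/andP/idP => [[]|le_pM] //; split=> //; apply: leq_trans le_Mn.
Qed.

(** * Codes of partitions and their matrix entries *)

Section Codes.
Variable n : nat.
Implicit Types f g : pcode n.

(** The weight of a code in [pcode n] may differ from [n]: erasing corners lowers the weight but
    stays in the same type. *)
Definition weight f := \sum_(i < n) i.+1 * f i.

Definition entry f (p : nat * nat) := digit m (mult_of f p.1) p.2.

(** Inverse to [entry] on digit families that are supported in the box and have total weight at most
    [n]. *)
Definition code (d : nat * nat -> nat) : pcode n :=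
  [ffun i : 'I_n => inord (\sum_(l < n.+1) d (i.+1, val l) * m ^ l)].

Lemma mult_of_ord f (i : 'I_n) : mult_of f i.+1 = f i.
Proof. by rewrite /mult_of valK. Qed.

Lemma mult_of_large f N : n < N -> mult_of f N = 0.
Proof. by case: N => // N lt_nN; rewrite /mult_of insubN // -leqNgt. Qed.

Lemma leq_mult_of f N : N * mult_of f N <= weight f.
Proof.
case: N => // N; case: (ltnP N n) => [lt_Nn|]; last first.
  by rewrite -ltnS => /mult_of_large->; rewrite muln0.
by rewrite (mult_of_ord f (Ordinal lt_Nn)) /weight (bigD1 (Ordinal lt_Nn)) //= leq_addr.
Qed.

Lemma mult_of_lt f N : mult_of f N < m ^ n.+1.
Proof.
apply: leq_ltn_trans (ltn_expl _ m_gt1); case: N => // N; rewrite /mult_of.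
by case: insub => // i; rewrite (leq_trans _ (leqnSn n)) // -ltnS ltn_ord.
Qed.

Lemma entry_lt f p : entry f p < m.
Proof. exact: ltn_digit. Qed.

(** A nonzero digit at [(N, l)] forces [m ^ l <= mult_of f N], so [pweight (N, l)] is at most the
    weight of [f]. *)
Lemma entry_supp M f p : weight f <= M -> p \notin box M -> entry f p = 0.
Proof.
case: p => -[|N] l; first by rewrite /entry digit0n.
rewrite mem_box /pweight /= -ltnNge => le_fM lt_M.
rewrite /entry /digit /= divn_small ?mod0n //.
rewrite -(ltn_pmul2l (ltn0Sn N)) (leq_ltn_trans _ lt_M) //.
exact: leq_trans (leq_mult_of _ _) le_fM.
Qed.

Lemma entry_inj f g : entry f =1 entry g -> f = g.
Proof.
move=> eq_fg; apply/ffunP=> i; apply: val_inj => /=.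
rewrite -!mult_of_ord -(sum_digits (mult_of_lt f i.+1)) -(sum_digits (mult_of_lt g i.+1)).
by apply: eq_bigr => l _; congr (_ * _); apply: (eq_fg (i.+1, val l)).
Qed.

Lemma sum_box (F : nat * nat -> nat) : (forall p, p \notin box n -> F p = 0) ->
  \sum_(p <- box n) F p = \sum_(i < n) \sum_(l < n.+1) F (i.+1, val l).
Proof.
move=> F0; rewrite big_filter big_mkcond big_allpairs.
have -> : iota 1 n = index_iota 1 n.+1 by rewrite /index_iota subn1.
rewrite big_add1 [n.+1.-1]/= big_mkord.
apply: eq_bigr => i _; rewrite -(big_mkord xpredT (fun l => F (i.+1, l))) /index_iota subn0.
apply: eq_bigr => l _; case: ifPn => // ge_n.
by rewrite F0 // mem_box negb_and ge_n orbT.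
Qed.

Lemma weight_entry f : weight f <= n ->
  weight f = \sum_(p <- box n) pweight p * entry f p.
Proof.
move=> le_fn; rewrite sum_box => [|p p_box]; last by rewrite (entry_supp le_fn p_box) muln0.
apply: eq_bigr => i _; rewrite -mult_of_ord -{1}(sum_digits (mult_of_lt f i.+1)) big_distrr.
by apply: eq_bigr => l _; rewrite /entry /pweight /= -mulnA; congr (_ * _); rewrite mulnC.
Qed.

Section CodeTheory.
Variable d : nat * nat -> nat.
Hypothesis d_lt : forall p, d p < m.
Hypothesis d_supp : forall p, p \notin box n -> d p = 0.
Hypothesis d_le : \sum_(p <- box n) pweight p * d p <= n.

Let d_sum :
  \sum_(p <- box n) pweight p * d p
    = \sum_(i < n) i.+1 * \sum_(l < n.+1) d (i.+1, val l) * m ^ l.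
Proof.
rewrite sum_box => [|p p_box]; last by rewrite d_supp // muln0.
apply: eq_bigr => i _; rewrite big_distrr.
by apply: eq_bigr => l _; rewrite /pweight /= -mulnA; congr (_ * _); rewrite mulnC.
Qed.

(** No value is lost in [inord]: each multiplicity is at most the total weight, which is at most
    [n]. *)
Lemma codeE (i : 'I_n) : code d i = \sum_(l < n.+1) d (i.+1, val l) * m ^ l :> nat.
Proof.
rewrite ffunE inordK // ltnS (leq_trans _ d_le) // d_sum (bigD1 i) //=.
by rewrite -[X in X <= _]mul1n (leq_trans _ (leq_addr _ _)) // leq_mul2r orbT.
Qed.

Lemma weight_code : weight (code d) = \sum_(p <- box n) pweight p * d p.
Proof. by rewrite d_sum; apply: eq_bigr => i _; rewrite codeE. Qed.

Lemma entry_code : entry (code d) =1 d.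
Proof.
move=> [N l]; case: (boolP ((N, l) \in box n)) => [|N_out]; last first.
  by rewrite (entry_supp (M := n)) ?weight_code // d_supp.
case: N => [|N]; rewrite mem_box //= /pweight /= => N_box.
have lt_l := ltn_expl l m_gt1.
have lt_Nn : N < n by nia.
have lt_ln : l < n.+1 by nia.
rewrite /entry; have /= -> := mult_of_ord (code d) (Ordinal lt_Nn).
by rewrite codeE /= (digit_sum _ _ (d := fun l => d (N.+1, l))) ?lt_ln.
Qed.

End CodeTheory.

(** * The map [rho] on codes of weight at most [n] *)

Lemma rho_code f : rho m f = code (entry f \o src).
Proof.
apply/ffunP=> i; rewrite !ffunE /mult_of_mats; congr inord.
apply: eq_bigr => l _; congr (_ * _); rewrite /= /entry /src /=.
have := mval_eq0 (ltn0Sn i); have := pexp_mval_dvd i.+1.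
case: (mval m i.+1) => [|k] /= dvd; case: ifP => //= dvdm _.
  by rewrite /pfmat divn1.
have [q ->] := dvdnP dvd; rewrite /pfmat mulnK ?expn_gt0 ?(ltnW m_gt1) //.
by rewrite expnSr mulnA mulnK //; lia.
Qed.

Lemma sum_entry_src f : weight f <= n ->
  \sum_(p <- box n) pweight p * (entry f \o src) p = weight f.
Proof.
move=> le_fn; under eq_bigr do rewrite -pweight_src /=.
by rewrite (sum_box_src n (fun p => pweight p * entry f p)) -weight_entry.
Qed.

Lemma entry_rho f : weight f <= n -> entry (rho m f) =1 entry f \o src.
Proof.
move=> le_fn; rewrite rho_code; apply: entry_code => [p|p p_out|]; first exact: entry_lt.
  by rewrite /= (entry_supp le_fn) // box_src.
by rewrite sum_entry_src.
Qed.

Lemma weight_rho f : weight f <= n -> weight (rho m f) = weight f.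
Proof.
move=> le_fn; rewrite rho_code weight_code ?sum_entry_src // => p p_out.
by rewrite /= (entry_supp le_fn) // box_src.
Qed.

Lemma rho_inj f g : weight f <= n -> weight g <= n -> rho m f = rho m g -> f = g.
Proof.
move=> le_fn le_gn eq_fg; apply: entry_inj => p; case: (posnP p.1) => [p0|p_gt0].
  by rewrite /entry p0 !digit0n.
rewrite -(dstK p_gt0).
by rewrite -[LHS](entry_rho le_fn) -[RHS](entry_rho le_gn) eq_fg.
Qed.

Lemma weight_iter f k : weight f <= n -> weight (iter k (rho m (n:=n)) f) = weight f.
Proof. by move=> le_fn; elim: k => //= k IHk; rewrite weight_rho IHk. Qed.

(** Injectivity of [rho] is established only on the codes of weight at most [n]; this set is stable
    under [rho], so the local form of symmetry applies. *)
Lemma fconnect_rhoC f g : weight f <= n -> weight g <= n ->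
  fconnect (rho m (n:=n)) f g = fconnect (rho m (n:=n)) g f.
Proof.
pose W : {pred pcode n} := [pred f | weight f <= n].
apply: (@fconnect_sym_in _ (rho m (n:=n)) W) => [h|h1 h2].
  by rewrite !inE => le_hn; rewrite weight_rho.
by rewrite !inE => ? ?; apply: rho_inj.
Qed.

(** The root is picked from the set of points reachable from the code, and [f] and [g] reach the
    same points. *)
Lemma froot_rho f g : weight f <= n -> weight g <= n ->
  fconnect (rho m (n:=n)) f g -> froot (rho m (n:=n)) f = froot (rho m (n:=n)) g.
Proof.
move=> le_fn le_gn fg; have gf : fconnect (rho m (n:=n)) g f by rewrite fconnect_rhoC.
rewrite /root (@eq_pick _ _ (fconnect (rho m (n:=n)) g)) => [|h].
  by case: pickP => // /(_ g); rewrite connect0.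
by apply/idP/idP; apply: connect_trans.
Qed.

(** * Separating the corners from the other entries *)

Definition nilp : pcode n := [ffun=> ord0].

Definition mix f g := code (fun p => if corner p then entry f p else entry g p).

(** All corners come from the empty partition, so this erases the corners of [f]. *)
Definition rest f := mix nilp f.

Definition corner_weight f := \sum_(p <- box n | corner p) pweight p * entry f p.

Definition rest_weight f := \sum_(p <- box n | ~~ corner p) pweight p * entry f p.

Lemma weight_split f : weight f <= n -> weight f = corner_weight f + rest_weight f.
Proof. by move/weight_entry->; rewrite (bigID corner). Qed.

Lemma entry_nilp p : entry nilp p = 0.
Proof.
rewrite /entry; case: p.1 => [|N] /=; first exact: digit0n.
by case: insub => [i|]; rewrite ?ffunE digit0n.
Qed.

Lemma weight_nilp : weight nilp = 0.
Proof. by apply: big1 => i _; rewrite ffunE muln0. Qed.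

Lemma corner_weight_nilp : corner_weight nilp = 0.
Proof. by apply: big1 => p _; rewrite entry_nilp muln0. Qed.

Lemma rest_weight_nilp : rest_weight nilp = 0.
Proof. by apply: big1 => p _; rewrite entry_nilp muln0. Qed.

Lemma weight_eq0 f : weight f = 0 -> f = nilp.
Proof.
by move=> f0; apply: entry_inj => p; rewrite entry_nilp (entry_supp (M := 0)) ?f0.
Qed.

Section Mix.
Variables f g : pcode n.
Hypotheses (le_fn : weight f <= n) (le_gn : weight g <= n).
Hypothesis le_fgn : corner_weight f + rest_weight g <= n.

Let mix_sum :
  \sum_(p <- box n) pweight p * (if corner p then entry f p else entry g p)
    = corner_weight f + rest_weight g.
Proof.
rewrite (bigID corner); congr (_ + _); apply: eq_bigr => p /=; first by move->.
by move/negPf->.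
Qed.

Lemma entry_mix : entry (mix f g) =1 (fun p => if corner p then entry f p else entry g p).
Proof.
apply: entry_code; last by rewrite mix_sum.
  by move=> p; case: ifP; rewrite entry_lt.
by move=> p p_out; rewrite !(entry_supp _ p_out) ?if_same.
Qed.

Lemma weight_mix : weight (mix f g) = corner_weight f + rest_weight g.
Proof.
rewrite weight_code ?mix_sum //.
by move=> p p_out; rewrite !(entry_supp _ p_out) ?if_same.
Qed.

End Mix.

Lemma rest_weight_le f : weight f <= n -> rest_weight f <= n.
Proof. by move=> le_fn; rewrite (leq_trans _ le_fn) // (weight_split le_fn) leq_addl. Qed.

Lemma entry_rest f : weight f <= n ->
  entry (rest f) =1 (fun p => if corner p then 0 else entry f p).
Proof.
move=> le_fn p; rewrite entry_mix ?entry_nilp ?weight_nilp //.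
by rewrite corner_weight_nilp rest_weight_le.
Qed.

Lemma weight_rest f : weight f <= n -> weight (rest f) = rest_weight f.
Proof.
move=> le_fn; rewrite weight_mix ?weight_nilp ?corner_weight_nilp //.
exact: rest_weight_le.
Qed.

Lemma dvdn_rest_weight f : m %| rest_weight f.
Proof.
rewrite /rest_weight; elim/big_ind: _ => [|x y|p /dvdn_pweight].
- exact: dvdn0.
- exact: dvdn_add.
exact: dvdn_mulr.
Qed.

Lemma eq_rest f g : weight f <= n -> weight g <= n -> rest f = rest g ->
  (forall p, corner p -> entry f p = entry g p) -> f = g.
Proof.
move=> le_fn le_gn eq_fg eq_c; apply: entry_inj => p.
case: (boolP (corner p)) => [/eq_c //|/negPf c'].
by have := entry_rest le_fn p; rewrite eq_fg entry_rest // c'.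
Qed.

Lemma weight_rest_le f : weight f <= n -> weight (rest f) <= n.
Proof. by move=> le_fn; rewrite weight_rest // rest_weight_le. Qed.

(** The map [src] sends corners to corners and other positions to other positions, so erasing the
    corners commutes with the rotation. *)
Lemma rest_rho f : weight f <= n -> rest (rho m f) = rho m (rest f).
Proof.
move=> le_fn; apply: entry_inj => p.
rewrite entry_rest ?weight_rho // !entry_rho ?weight_rest_le //=.
by rewrite entry_rest // corner_src.
Qed.

Lemma rest_iter f k : weight f <= n ->
  rest (iter k (rho m (n:=n)) f) = iter k (rho m (n:=n)) (rest f).
Proof. by move=> le_fn; elim: k => //= k IHk; rewrite rest_rho ?weight_iter // IHk. Qed.

Lemma entry_iter f k p : weight f <= n -> corner p ->
  entry (iter k (rho m (n:=n)) f) p = entry f p.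
Proof.
move=> le_fn c; elim: k => //= k IHk.
by rewrite entry_rho ?weight_iter //= src_corner.
Qed.

(** Corners are constant along an orbit, so within one orbit a code is determined by its other
    entries. *)
Lemma eq_rest_fconnect f g h : weight f <= n ->
  fconnect (rho m (n:=n)) f g -> fconnect (rho m (n:=n)) f h -> rest g = rest h -> g = h.
Proof.
move=> le_fn /iter_findex <- /iter_findex <- eq_r.
by apply: eq_rest => //[||p c]; rewrite ?weight_iter // !entry_iter.
Qed.

(** The map [rest] commutes with [rho] and is injective on the orbit of [f], so it carries this
    orbit bijectively onto that of [rest f]. *)
Lemma order_rest f : weight f <= n ->
  order (rho m (n:=n)) (rest f) = order (rho m (n:=n)) f.
Proof.
move=> le_fn; rewrite /order -(card_in_image (f := rest) (A := fconnect (rho m (n:=n)) f)).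
  apply: eq_card => g; apply/idP/imageP => [|[h /iter_findex <- ->]].
    by move/iter_findex=> <-; exists (iter (findex (rho m (n:=n)) (rest f) g) (rho m (n:=n)) f);
      rewrite ?rest_iter //; apply: fconnect_iter.
  by rewrite rest_iter //; apply: fconnect_iter.
by move=> g h; apply: eq_rest_fconnect.
Qed.

(** * Fibres of [rest] at a given weight *)

Definition fiber M g := [set f : pcode n | (weight f == M) && (rest f == g)].

(** Replacing the non-corner entries by zeros, [h] to [mix h nilp], is a bijection between the two
    fibres; its inverse [c] to [mix c g] glues [g] back. Thus the size of a nonempty fibre depends
    only on [M - weight g]. *)
Lemma card_fiber M f : M <= n -> weight f = M ->
  #|fiber M (rest f)| = #|fiber (M - weight (rest f)) nilp|.
Proof.
move=> le_Mn wf; set g := rest f.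
have le_fn : weight f <= n by rewrite wf.
have wg : weight g = rest_weight f by apply: weight_rest.
have le_gn : weight g <= n by apply: weight_rest_le.
have le_gM : weight g <= M by rewrite wg -wf (weight_split le_fn) leq_addl.
(* Having no corners, [g] carries all its weight outside them. *)
have rwg : rest_weight g = weight g.
  by rewrite wg; apply: eq_bigr => p c; rewrite entry_rest // (negPf c).
have in_fiber h : h \in fiber M g ->
    [/\ weight h <= n, rest h = g & corner_weight h = M - weight g].
  rewrite inE => /andP[/eqP wh /eqP rh]; have le_hn : weight h <= n by rewrite wh.
  by split=> //; rewrite -wh (weight_split le_hn) -rh weight_rest // addnK.
have in_core c : c \in fiber (M - weight g) nilp ->
    [/\ weight c <= n, corner_weight c = M - weight g &
       forall p, ~~ corner p -> entry c p = 0].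
  rewrite inE => /andP[/eqP wc /eqP rc]; have le_cn : weight c <= n by lia.
  split=> // [|p c']; last by have := entry_rest le_cn p; rewrite rc entry_nilp (negPf c').
  by rewrite -wc (weight_split le_cn) -weight_rest // rc weight_nilp addn0.
have mixn h : h \in fiber M g -> corner_weight h + rest_weight nilp <= n.
  by case/in_fiber=> _ _ ->; rewrite rest_weight_nilp; lia.
have mixg c : c \in fiber (M - weight g) nilp -> corner_weight c + rest_weight g <= n.
  by case/in_core=> _ -> _; rewrite rwg; lia.
rewrite -(card_in_imset (f := fun h => mix h nilp)); last first.
  move=> h1 h2 h1P h2P /= eq_h.
  have [le1 r1 _] := in_fiber _ h1P; have [le2 r2 _] := in_fiber _ h2P.
  apply: eq_rest => // [|p c]; first by rewrite r1.
  have := entry_mix le1 _ (mixn _ h1P) p; rewrite eq_h entry_mix ?weight_nilp ?mixn // c.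
  by move=> ->.
apply: eq_card => c; apply/imsetP/idP => [[h hP ->]|cP].
  have [le_hn _ cw] := in_fiber _ hP.
  have wm : weight (mix h nilp) = M - weight g.
    by rewrite weight_mix ?weight_nilp ?mixn // cw rest_weight_nilp addn0.
  rewrite inE wm eqxx /=; apply/eqP/entry_inj => p.
  rewrite entry_rest ?wm; last by lia.
  by rewrite entry_mix ?weight_nilp ?mixn // !entry_nilp; case: (corner p).
have [le_cn cw c0] := in_core _ cP.
have wm : weight (mix c g) = M by rewrite weight_mix ?mixg // cw rwg subnK.
have hP : mix c g \in fiber M g.
  rewrite inE wm eqxx /=; apply/eqP/entry_inj => p.
  rewrite entry_rest ?wm // entry_mix ?mixg //.
  by rewrite /g entry_rest //; case: (corner p).
exists (mix c g) => //; apply: entry_inj => p.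
rewrite entry_mix ?weight_nilp ?wm ?mixn // entry_mix ?mixg // entry_nilp.
by case: (boolP (corner p)) => // /c0.
Qed.

(** * Counting orbits by representatives *)

Lemma partitions_weight : partitions n = [set f | weight f == n].
Proof. by []. Qed.

(* Every orbit contains exactly one partition whose rest is the chosen root of its own orbit:
   an orbit has constant corners, so it is mapped injectively onto an orbit by [rest]. *)
Lemma o_rhoE k :
  o_rho m n k = #|[set f in partitions n | (order (rho m (n:=n)) f == k) &&
                     (froot (rho m (n:=n)) (rest f) == rest f)]|.
Proof.
rewrite /o_rho partitions_weight; set r := rho m (n:=n); set S' := (X in _ = #|pred_of_set X|).
pose orb f := [set g | fconnect r f g].
have S'W f : f \in S' -> weight f <= n by rewrite !inE => /andP[/eqP->].
have orbP f g : orb f = orb g -> fconnect r f g.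
  by move/setP/(_ g); rewrite !inE connect0.
(* Two representatives of one orbit have connected rests; both rests are roots, hence equal, and so
   are the representatives. *)
rewrite -(card_in_imset (f := orb) (D := S')); last first.
  move=> f g fS gS /orbP fg; have le_fn := S'W f fS; have le_gn := S'W g gS.
  have rfg : fconnect r (rest f) (rest g).
    by rewrite -(iter_findex fg) rest_iter //; apply: fconnect_iter.
  apply: (eq_rest_fconnect le_fn (connect0 _ _) fg).
  move: fS gS; rewrite !inE => /and3P[_ _ /eqP <-] /and3P[_ _ /eqP <-].
  by apply: froot_rho => //; apply: weight_rest_le.
apply: eq_card => O; apply/imsetP/imsetP => -[f fS ->]; last first.
  by exists f => //; move: fS; rewrite !inE => /and3P[-> ->].
move: fS; rewrite !inE => /andP[/eqP wf /eqP of_k].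
have le_fn : weight f <= n by rewrite wf.
have z_conn := connect_root (frel r) (rest f).
(* Rotating [f] as many times as it takes [rest f] to reach its root yields a representative in the
   orbit of [f]. *)
pose i := findex r (rest f) (froot r (rest f)).
have le_in : weight (iter i r f) <= n by rewrite weight_iter.
have rest_i : rest (iter i r f) = froot r (rest f) by rewrite rest_iter // iter_findex.
have f_conn : fconnect r f (iter i r f) by apply: fconnect_iter.
have eq_orb : fconnect r f =1 fconnect r (iter i r f).
  move=> h; apply/idP/idP; apply: connect_trans => //.
  by rewrite fconnect_rhoC.
exists (iter i r f); last by apply/setP=> h; rewrite !inE eq_orb.
rewrite !inE weight_iter // wf eqxx /= /order -(eq_card eq_orb) [X in X == k]of_k eqxx /=.
rewrite rest_i; apply/eqP/esym/froot_rho => //; first exact: weight_rest_le.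
by rewrite -rest_i weight_rest_le.
Qed.

(** * Codes of a given weight and partition numbers *)

Lemma card_level M :
  #|[set f : pcode n | weight f == M]| = \sum_(g : pcode n) #|fiber M g|.
Proof.
rewrite -sum1dep_card (partition_big rest xpredT) //; apply: eq_bigr => g _.
by rewrite sum1dep_card.
Qed.

End Codes.

(** Codes of weight [M] in the larger type [pcode n] match the partitions of [M] by having the same
    matrix entries. This lets the induction on the weight run inside one type. *)
Lemma card_level_npart M n : M <= n -> #|[set f : pcode n | weight f == M]| = npart M.
Proof.
move=> le_Mn; pose up (f : pcode M) : pcode n := code n (entry f).
have supp (k : nat) (f : pcode k) : weight f = M -> forall p, p \notin box M -> entry f p = 0.
  by move=> wf p; apply: entry_supp; rewrite wf.
have supp' (k : nat) (f : pcode k) : weight f = M -> forall p, p \notin box n -> entry f p = 0.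
  move=> wf p p_out; apply: (supp _ _ wf); apply: contra p_out; rewrite !mem_box.
  by case/andP=> -> /leq_trans->.
have sumM (k : nat) (f : pcode k) : M <= k -> weight f = M ->
    \sum_(p <- box M) pweight p * entry f p = M.
  move=> le_Mk wf; rewrite -{2}wf weight_entry ?wf //; apply/esym/sum_box_widen => // p p_out.
  by rewrite (supp _ _ wf) ?muln0.
have sumn (k : nat) (f : pcode k) : M <= k -> weight f = M ->
    \sum_(p <- box n) pweight p * entry f p = M.
  move=> le_Mk wf; rewrite (sum_box_widen le_Mn) ?(sumM k) // => p p_out.
  by rewrite (supp _ _ wf) ?muln0.
have up_entry f : weight f = M -> entry (up f) =1 entry f.
  move=> wf; apply: entry_code; [exact: entry_lt | exact: supp' | by rewrite sumn].
rewrite /npart -[RHS](card_in_imset (f := up)); last first.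
  move=> f g; rewrite !inE => /eqP wf /eqP wg eq_fg; apply: entry_inj => p.
  by rewrite -(up_entry f) // eq_fg up_entry.
apply: eq_card => f; rewrite inE; apply/eqP/imsetP => [wf|[g]].
  have e : entry (code M (entry f)) =1 entry f.
    by apply: entry_code; [exact: entry_lt | exact: supp | rewrite sumM].
  have w : weight (code M (entry f)) = M.
    by rewrite weight_code ?sumM //; exact: supp.
  exists (code M (entry f)); first by rewrite inE; apply/eqP.
  by apply: entry_inj => p; rewrite up_entry // e.
rewrite inE => /eqP wg ->; rewrite weight_code ?sumn //; exact: supp'.
Qed.

(** * The congruence along the progression *)

Section Congruence.
Variables A B C : nat.
Hypothesis C_npart : forall n, C %| npart (A * n + B).
Hypotheses (lt_BA : B < A) (A_m : A %| m).

(** The weight of a rest is a multiple of [m], hence of [A], so removing it stays in the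
    progression. Only the empty rest has weight 0; any other one strictly lowers the index. *)
Lemma card_fiber_progression n t (g : pcode n) : A * t + B <= n ->
  #|fiber (A * t + B) g| = 0 \/
  exists2 u, u + (g != nilp n) <= t & #|fiber (A * t + B) g| = #|fiber (A * u + B) (nilp n)|.
Proof.
move=> le_n; have [->|[f]] := set_0Vmem (fiber (A * t + B) g); first by left; rewrite cards0.
rewrite inE => /andP[/eqP wf /eqP rf]; right; have le_fn : weight f <= n by rewrite wf.
have wg : weight g = rest_weight f by rewrite -rf weight_rest.
have [u eq_u] := dvdnP (dvdn_trans A_m (dvdn_rest_weight f)).
have le_r : rest_weight f <= A * t + B by rewrite -wf (weight_split le_fn) leq_addl.
(* From [u * A <= A * t + B] and [B < A] it follows that [u * A < A * (t + 1)]. *)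
have le_ut : u <= t by nia.
have u_gt0 : (g != nilp n) <= u.
  case: eqP => // g_neq; rewrite lt0n; apply/eqP => u0.
  by apply: g_neq; apply: weight_eq0; rewrite wg eq_u u0.
exists (t - u); first by lia.
by rewrite -{1}rf card_fiber // rf wg; congr #|pred_of_set (fiber _ _)|; nia.
Qed.

(** The number [npart (A * t + B)] is the sum of all fibre sizes. By induction [C] divides those
    over nonempty rests, so it divides the remaining one. *)
Lemma dvdn_card_fiber_nilp n t : A * t + B <= n -> C %| #|fiber (A * t + B) (nilp n)|.
Proof.
elim/ltn_ind: t => t IHt le_n.
have := C_npart t; rewrite -(card_level_npart le_n) card_level (bigD1 (nilp n)) //=.
rewrite dvdn_addl //; elim/big_ind: _ => [|x y|g g_neq]; [by []|exact: dvdn_add|].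
have [->//|[u]] := card_fiber_progression g le_n.
by rewrite g_neq addn1 => lt_ut ->; apply: IHt; nia.
Qed.

Lemma dvdn_card_fiber n t (g : pcode n) : A * t + B <= n -> C %| #|fiber (A * t + B) g|.
Proof.
move=> le_n; have [->//|[u le_ut ->]] := card_fiber_progression g le_n.
by apply: dvdn_card_fiber_nilp; nia.
Qed.

End Congruence.
End Digits.

Theorem theorem2 (m A B C : nat) :
  2 <= m -> 1 <= A -> 1 <= C ->
  (forall n, C %| npart (A * n + B)) ->
  B < A -> A %| m ->
  forall k n, 0 < k -> C %| o_rho m (A * n + B) k.
Proof.
move=> m_gt1 _ _ C_npart lt_BA A_m k t _; set n := A * t + B.
(* Grouped by their rest [g], the representatives form either the whole fibre over [g] or nothing,
   since both the orbit size and the root condition depend only on [g]. *)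
rewrite o_rhoE // partitions_weight -sum1dep_card (partition_big (@rest m n) xpredT) //=.
elim/big_ind: _ => [|x y|g _]; [exact: dvdn0 | exact: dvdn_add |].
rewrite sum1dep_card.
case: (boolP ((order (rho m (n:=n)) g == k) && (froot (rho m (n:=n)) g == g))) => [gP|gN].
  rewrite (@eq_card _ _ (fiber m n g)) => [|f].
    exact: (dvdn_card_fiber m_gt1 C_npart lt_BA A_m).
  rewrite !inE; case: (eqVneq (weight f) n) => //= wf.
  case: (eqVneq (rest m f) g) => [rf|]; rewrite ?andbF // andbT.
  by rewrite -(order_rest m_gt1) ?wf // rf.
rewrite eq_card0 // => f; rewrite !inE; apply: contraNF gN.
case/andP=> /and3P[/eqP wf + +] /eqP rf.
by rewrite -(order_rest m_gt1) ?wf // rf => -> ->.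
Qed.
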